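(* Let $S$ and $T$ be semigroups such that $S\cup T$ is a semigroup (containing $S$ and $T$ as subsemigroups) and $T$ is an ideal of $S\cup T$. Let $C$ be a compact Hausdorff right topological semigroup and let $\phi:T\to C$ be an $S$-independent homomorphism with $\phi[T]$ contained in the topological center of $C$; denote also by $\phi$ its continuous extension $\beta T\to C$. Let $F$ be a finite nonempty set of homomorphisms from $S\cup T$ into $S$ each of which is the identity on $S$, and let $D$ be a piecewise syndetic subset of $S$. Let $p$ be an idempotent in $\phi[\beta T]$ and let $U$ be a neighborhood of $p$ in $C$. Then there exists $w\in T$ such that $\phi(w)\in U$ and $\nu(w)\in D$ for every $\nu\in F$.
   Context: A homomorphism $\phi:T\to R$ (with $T$ an ideal of the semigroup $S\cup T$) is $S$-independent if $\phi(uw)=\phi(w)=\phi(wu)$ for all $w\in T$ and $u\in S$. A semigroup $C$ with a topology is right topological if for each $s\in C$ the map $x\mapsto xs$ is continuous; its topological center is the set of $s\in C$ for which $x\mapsto sx$ is continuous. For a discrete semigroup $X$, $\beta X$ is the Stone–Čech compactification (the space of ultrafilters on $X$, with points of $X$ identified with principal ultrafilters), with the semigroup operation extended so that $A\in pq$ iff $\{x\in X: x^{-1}A\in q\}\in p$, where $x^{-1}A=\{y:xy\in A\}$; this makes $\beta X$ a compact Hausdorff right topological semigroup with $X$ in its topological center. Any function from $X$ into a compact Hausdorff space extends uniquely to a continuous function on $\beta X$. A compact Hausdorff right topological semigroup has a smallest two-sided ideal $K(\cdot)$. A subset $D\subseteq X$ is piecewise syndetic if $D\in p$ for some $p\in K(\beta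 X)$. *)

(* Defs.v *)
From HB Require Import structures.
From mathcomp Require Import all_boot.
From mathcomp Require Import boolp classical_sets filter topology.

Set Implicit Arguments.
Unset Strict Implicit.
Unset Printing Implicit Defensive.

Local Open Scope classical_set_scope.
Local Open Scope group_scope.

HB.mixin Record isRightTopological C of Topological C & Magma C := {
  mulgr_continuous : forall s : C, continuous (fun x : C => x * s)
}.

#[short(type="rightTopologicalSemigroupType")]
HB.structure Definition RightTopologicalSemigroup :=
  {C of Topological C & Semigroup C & isRightTopological C}.

Definition topological_center (C : rightTopologicalSemigroupType) : set C :=
  [set s | continuous (fun x : C => s * x)].
Arguments topological_center : clear implicits.

Section Ideals.
Variable M : semigroupType.

Definition two_sided_ideal (I : set M) : Prop :=
  I !=set0 /\ forall x y, I y -> I (x * y) /\ I (y * x).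

(* If M has a smallest two-sided ideal, this intersection is that ideal. *)
Definition smallest_ideal : set M :=
  [set x | forall I, two_sided_ideal I -> I x].

End Ideals.

(* The points of the Stone-Cech compactification of the discrete space X. *)
Record beta (X : Type) : Type := Beta {
  ultraset :> set X -> Prop;
  ultrasetP : UltraFilter ultraset
}.
#[global] Existing Instance ultrasetP.

#[global] Instance beta_filter (X : Type) (p : beta X) : Filter p.
Proof. by have [[]] := ultrasetP p. Qed.

Lemma beta_eq (X : Type) (p q : beta X) :
  (forall A, p A <-> q A) -> p = q.
Proof.
case: p q => [p pU] [q qU] /= pq.
have e : p = q by apply/predeqP.
by case: q / e qU {pq} => qU; congr Beta; apply: Prop_irrelevance.
Qed.

HB.instance Definition _ (X : Type) := gen_eqMixin (beta X).
HB.instance Definition _ (X : Type) := gen_choiceMixin (beta X).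

Definition principal (X : Type) (x : X) : beta X :=
  Beta (principal_filter_ultra x).

Section BetaTopology.
Variable X : Type.

Definition beta_basic (A : set X) : set (beta X) := [set p | p A].

Lemma beta_basic_cover : \bigcup_(A in [set: set X]) beta_basic A = setT.
Proof.
by rewrite -subTset => p _; exists setT => //; apply: filterT.
Qed.

Lemma beta_basic_join (A B : set X) (p : beta X) :
  setT A -> setT B -> beta_basic A p -> beta_basic B p ->
  exists k, [/\ setT k, beta_basic k p &
    beta_basic k `<=` beta_basic A `&` beta_basic B].
Proof.
move=> _ _ pA pB; exists (A `&` B); split=> //; first exact: (@filterI _ (p : set_system X)).
by move=> q; rewrite /beta_basic /= => qAB; split; apply: filterS qAB => x [].
Qed.

HB.instance Definition _ :=
  isBaseTopological.Build (beta X) beta_basic_cover beta_basic_join.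

Lemma beta_basic_open (A : set X) : open (beta_basic A).
Proof. by exists [set A] => //; rewrite bigcup_set1. Qed.

Lemma beta_nbhsP (p : beta X) (V : set (beta X)) :
  nbhs p V <-> exists2 A : set X, p A & beta_basic A `<=` V.
Proof.
split=> [|[A pA AV]]; last first.
  by apply: (filterS AV); apply: open_nbhs_nbhs; split => //;
     exact: beta_basic_open.
rewrite nbhsE => -[B [[D' _ <-] [A D'A pA]] BV]; exists A => //.
by move=> q qA; apply: BV; exists A.
Qed.

End BetaTopology.

Section BetaSemigroup.
Variable X : semigroupType.
Implicit Types p q r : beta X.

Definition beta_mul_system p q : set_system X :=
  [set A | p [set x | q [set y | A (x * y)]]].

Lemma beta_mul_ultra p q : UltraFilter (beta_mul_system p q).
Proof.
have pF : ProperFilter (beta_mul_system p q).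
  apply: Build_ProperFilter_ex.
    move=> A pqA; have [x qx] := @filter_ex _ p _ _ pqA.
    by have [y Axy] := @filter_ex _ q _ _ qx; exists (x * y).
  split.
  - have qT x : q [set y | [set: X] (x * y)] by exact: (@filterT _ q).
    exact: (@filterE _ p).
  - move=> A B; rewrite /beta_mul_system /= => pA pB.
    have pAB := @filterI _ _ (beta_filter p) _ _ pA pB.
    by apply: (@filterS _ _ (beta_filter p) _ _ _ pAB) => x [qA qB];
       apply: (@filterI _ _ (beta_filter q) _ _ qA qB).
  - move=> A B AB; apply: (@filterS _ _ (beta_filter p)) => x.
    by apply: (@filterS _ _ (beta_filter q)) => y; apply: AB.
split=> // G GF sub; rewrite eqEsubset; split=> // A GA.
have [//|pnA] := in_ultra_setVsetC [set x | q [set y | A (x * y)]] (ultrasetP p).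
suff /sub GnA : beta_mul_system p q (~` A).
  by have [x []] := @filter_ex _ G _ _ (filterI GA GnA).
apply: (@filterS _ _ (beta_filter p) _ _ _ pnA) => x /= nqA.
by have [] := in_ultra_setVsetC [set y | A (x * y)] (ultrasetP q).
Qed.

Definition beta_mul p q : beta X := Beta (beta_mul_ultra p q).

Lemma beta_mulA : associative beta_mul.
Proof.
move=> p q r; apply: beta_eq => A; rewrite /= /beta_mul_system /=.
suff -> : (fun x => q [set y | r [set z | A (x * (y * z))]]) =
          (fun x => q [set y | r [set z | A (x * y * z)]]) by [].
apply/funext => x; congr (ultraset q _); apply/funext => y.
by congr (ultraset r _); apply/funext => z; rewrite /= mulgA.
Qed.

HB.instance Definition _ := isSemigroup.Build (beta X) beta_mulA.

Lemma beta_mulE p q (A : set X) :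
  (p * q)%g A <-> p [set x | q [set y | A (x * y)]].
Proof. by []. Qed.

Lemma beta_mulr_continuous q : continuous (fun p : beta X => p * q).
Proof.
move=> p V /beta_nbhsP[A pqA AV]; apply/beta_nbhsP.
by exists [set x | q [set y | A (x * y)]] => // r rA; apply: AV.
Qed.

HB.instance Definition _ :=
  isRightTopological.Build (beta X) beta_mulr_continuous.

Definition piecewise_syndetic (D : set X) : Prop :=
  exists2 p : beta X, smallest_ideal p & p D.

End BetaSemigroup.

(* S and T are subsemigroups of M, given as types with inclusion val. When T is
   an ideal of M, the v below is the element uw (resp. wu) of T. *)
Definition independent (M : semigroupType) (PS PT : pred M)
    (S : subSemigroupType PS) (T : subSemigroupType PT) (R : Type)
    (phi : T -> R) : Prop :=
  forall (u : S) (w v : T),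
    (val v = val u * val w -> phi v = phi w) /\
    (val v = val w * val u -> phi v = phi w).

(* Main.v *)
(** Take [q] in [K(beta S)] containing [D] and a minimal idempotent [r] of
    [beta S] with [q * r = q]. Inside [beta M], the fiber [Z] over [p] is a
    closed subsemigroup, stable under multiplication by [beta S] on both sides
    because [phi] is [S]-independent. An idempotent of [Z * r] yields an
    idempotent [w] in [Z] with [w <= r]. Each [nu] in [F] extends to a
    homomorphism [beta M -> beta S] fixing [r], so it sends [w] to an idempotent
    below [r], that is to [r] itself, and hence [q * w] to [q]. So the member
    [q * w] of [Z] contains the set of those [t] with [phi t] in [U] and every
    [nu t] in [D], which is therefore nonempty. *)
Require Import Defs.
From HB Require Import structures.
From mathcomp Require Import all_boot.
From mathcomp Require Import boolp classical_sets cardinality filter topology.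

Local Open Scope classical_set_scope.
Local Open Scope group_scope.

(** * Finite intersections and minimal closed sets *)

Lemma filter_finite_bigcap {X I : Type} (G : set_system X) (J : set I)
    (B : I -> set X) :
  Filter G -> finite_set J -> (forall i, J i -> G (B i)) ->
  G (\bigcap_(i in J) B i).
Proof.
move=> GF Jfin GB; have /finite_seqP[s JE] := finite_image B Jfin.
have GA A : A \in s -> G A.
  by move=> As; have [i Ji <-] : (B @` J) A by [rewrite JE]; apply: GB.
rewrite -[\bigcap_(i in J) B i](bigcap_image J B id) JE.
elim: s GA {JE} => [|A s IHs] GA; first by apply: filterE => x A.
have GAs : G (\bigcap_(A in [set` s]) A).
  by apply: IHs => A' As; apply: GA; rewrite inE As orbT.
apply: filterS (filterI (GA A (mem_head A s)) GAs) => x [Ax sx] A'.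
by rewrite /= inE => /orP[/eqP-> //|]; apply: sx.
Qed.

(** The members of a nonempty chain form a filter base, and a cluster point of it lies in each
    closed member. *)
Lemma chain_bigcap_nonempty (X : topologicalType) (G : set (set X)) :
  compact [set: X] -> G !=set0 -> total_on G subset ->
  (forall A, G A -> closed A /\ A !=set0) -> \bigcap_(A in G) A !=set0.
Proof.
move=> Xco [A0 GA0] Gtot Gcl.
have GF : ProperFilter (filter_from G id).
  apply: filter_from_proper => [|A /Gcl[]//].
  apply: filter_from_filter; first by exists A0.
  move=> A B GA GB; have [AB|BA] := Gtot A B GA GB.
    by exists A => // x Ax; split=> //; apply: AB.
  by exists B => // x Bx; split=> //; apply: BA.
have [|x [_ clx]] := Xco _ GF; first by exists A0.
exists x => A GA; have [Acl _] := Gcl A GA; apply: Acl => V xV.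
by apply: clx => //; exists A.
Qed.

(** Zorn's lemma is applied to complements in [A0], so that a maximal complement yields a minimal
    member of [P]. *)
Lemma compact_minimal_closed (X : topologicalType) (P : set (set X))
    (A0 : set X) :
  compact [set: X] -> P A0 -> (forall A, P A -> closed A /\ A !=set0) ->
  (forall G : set (set X), G `<=` P -> \bigcap_(A in G) A !=set0 ->
    P (\bigcap_(A in G) A)) ->
  exists A, [/\ P A, A `<=` A0 & forall B, P B -> B `<=` A -> A `<=` B].
Proof.
move=> Xco PA0 Pcl Pcap.
have [|B [PB Bmax]] := @Zorn_bigcup _ [set B | P (A0 `\` B)].
  move=> G GP Gtot /=; have [[B0 GB0]|G0] := pselect (G !=set0); last first.
    (* The empty chain is bounded by the empty set, whose complement in [A0] is [A0]. *)
    suff -> : \bigcup_(B in G) B = set0 by rewrite setD0.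
    by rewrite -subset0 => x [B GB]; case: G0; exists B.
  have -> : A0 `\` \bigcup_(B in G) B =
      \bigcap_(A in [set A0 `\` B | B in G]) A.
    rewrite bigcap_image eqEsubset; split=> x.
      by move=> [A0x Gx] B GB; split=> // Bx; apply: Gx; exists B.
    by move=> Gx; split=> [|[B GB Bx]]; [have [] := Gx _ GB0|have [] := Gx _ GB].
  have GP' : [set A0 `\` B | B in G] `<=` P by move=> _ [B /GP PB <-].
  apply: Pcap => //; apply: chain_bigcap_nonempty => // [||A /GP' /Pcl//].
    by exists (A0 `\` B0), B0.
  move=> _ _ [B GB <-] [B' GB' <-].
  by have [s|s] := Gtot B B' GB GB'; [right|left]; apply: setDS.
exists (A0 `\` B); split=> // A PA AB.
apply: contrapT => nBA; apply: (Bmax (~` A)).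
  split=> [x Bx /AB[]//|AcB]; apply: nBA => x [A0x nBx].
  by apply: contrapT => /AcB.
suff -> : [set B | P (A0 `\` B)] (~` A) = P A by [].
rewrite /= setDE setCK; congr P; apply/setIidPr => x /AB[]//.
Qed.

(** * Compact right topological semigroups *)

Section CompactSemigroup.
Context {C : rightTopologicalSemigroupType}.
Hypotheses (Cco : compact [set: C]) (CT2 : hausdorff_space C).

Lemma closed_mulr (A : set C) (c : C) : closed A -> closed [set a * c | a in A].
Proof.
move=> Acl; apply: compact_closed => //; apply: continuous_compact.
  by apply: continuous_subspaceT; exact: mulgr_continuous.
exact: subclosed_compact Acl Cco _.
Qed.

(* The Ellis-Numakura lemma. *)
Lemma idempotent_exists (A : set C) :
  closed A -> A !=set0 -> (forall x y, A x -> A y -> A (x * y)) ->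
  exists2 e, A e & e * e = e.
Proof.
move=> Acl A0 AM.
pose P (B : set C) :=
  [/\ closed B, B !=set0 & forall x y, B x -> B y -> B (x * y)].
have [|||B [[Bcl [e Be] BM] BA Bmin]] :=
    @compact_minimal_closed C P A Cco _ _ _.
- by split.
- by move=> B [].
- move=> G GP G0; split=> //.
    by apply: closed_bigI => B /GP[].
  move=> x y Gx Gy B GB; have [_ _ BM] := GP B GB.
  by apply: BM; [apply: Gx|apply: Gy].
exists e; first exact: BA.
(* Minimality gives [B * e = B], hence some [x] in [B] with [x * e = e]. The set of all such [x] is
   again a closed subsemigroup, so it is all of [B] and contains [e]. *)
have : P [set b * e | b in B].
  split; first exact: closed_mulr.
    by exists (e * e), e.
  move=> _ _ [x Bx <-] [y By <-]; exists (x * e * y); last by rewrite !mulgA.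
  by apply/BM/By/BM.
move=> /Bmin sub; have /sub [|x Bx xe] := Be.
  by move=> _ [x Bx <-]; apply: BM.
have : P (B `&` [set y | y * e = e]).
  split.
  - apply: closedI => //.
    apply: (@preimage_closed _ _ (fun y : C => y * e) [set e]).
      by move=> y _; exact: mulgr_continuous.
    exact/accessible_closed_set1/hausdorff_accessible.
  - by exists x.
  - by move=> y z [By ye] [Bz ze]; split; [apply: BM|rewrite /= -mulgA ze].
by move=> /Bmin /(_ (@subIsetl _ _ _)) /(_ e Be) [].
Qed.

(* The last clause says that [r] is minimal among the idempotents of [C]. *)
Lemma smallest_ideal_idempotent (q : C) : smallest_ideal q ->
  exists r, [/\ r * r = r, q * r = q &
    forall f, f * f = f -> f * r = f -> r * f = f -> f = r].
Proof.
move=> Kq.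
(* [P] singles out the closed left ideals. *)
pose P (L : set C) := [/\ closed L, L !=set0 & forall x y, L y -> L (x * y)].
have Pmul c : P [set a * c | a in [set: C]].
  split; first exact/closed_mulr/closedT.
    by exists (c * c), c.
  by move=> x _ [a _ <-]; exists (x * a) => //; rewrite mulgA.
have [|||L [[Lcl [l0 Ll0] LM] _ Lmin]] :=
    @compact_minimal_closed C P [set: C] Cco _ _ _.
- by split; [exact: closedT|exists q|].
- by move=> B [].
- move=> G GP G0; split=> //.
    by apply: closed_bigI => B /GP[].
  by move=> x y Gy B GB; have [_ _ BM] := GP B GB; apply: BM; apply: Gy.
have Lgen x y : L x -> L y -> exists a, y = a * x.
  move=> Lx /(Lmin _ (Pmul x)) [|a _ <-]; last by exists a.
  by move=> _ [a _ <-]; apply: LM.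
(* [L * C] is a two-sided ideal, so it contains [q]. *)
have [|l [Ll [c qE]]] := Kq [set z | exists l, L l /\ exists c, z = l * c].
  split; first by exists (l0 * l0), l0; split=> //; exists l0.
  move=> x _ [l [Ll [c ->]]]; split.
    by exists (x * l); split; [exact: LM|exists c; rewrite mulgA].
  by exists l; split=> //; exists (c * x); rewrite mulgA.
(* As [l] lies in [C * (x * l)] and [q = l * c], the element [q] lies in [C * (x * q)]: the left
   ideal [C * q] is minimal. *)
have qgen x : exists y, q = y * (x * q).
  have [|y ly] := Lgen (x * l) l _ Ll; first exact: LM.
  by exists y; rewrite {1}qE ly qE !mulgA.
have [|||_ [x _ <-] rr] := @idempotent_exists [set a * q | a in [set: C]].
- by have [] := Pmul q.
- by have [] := Pmul q.
- move=> _ _ [x _ <-] [y _ <-]; exists (x * q * y) => //.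
  by rewrite !mulgA.
have [y qy] := qgen x.
exists (x * q); split=> // [|f ff fr rf].
  by rewrite {1}qy -mulgA rr -qy.
(* Since [f = f * x * q], this gives [q = z * f], so [q * f = q] and [f = r * f = x * q * f = r]. *)
have [z qz] := qgen (f * x).
have fE : f * x * q = f by rewrite -mulgA fr.
by rewrite -rf qz fE -!mulgA ff.
Qed.

End CompactSemigroup.

(** * The space of ultrafilters *)

Lemma beta_compact (X : Type) : compact [set: beta X].
Proof.
rewrite compact_ultra => G GU _.
(* The limit of [G] is the ultrafilter of those [A] whose basic open set belongs to [G]. *)
have pF : ProperFilter [set A | G (@beta_basic X A)].
  apply: Build_ProperFilter_ex.
    by move=> A GA; have [q] := @filter_ex _ G _ _ GA; exact: (@filter_ex _ q).
  split.
  - by apply: (@filterE _ G) => q; exact: (@filterT _ q).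
  - move=> A B; apply: (@filterS2 _ G) => q; exact: (@filterI _ q).
  - move=> A B AB; apply: (@filterS _ G) => q; exact: (@filterS _ q).
have pU : UltraFilter [set A | G (@beta_basic X A)].
  split=> // H HF sub; rewrite eqEsubset; split=> // A HA.
  have [//|GnA] := in_ultra_setVsetC (beta_basic A) GU.
  suff /sub HnA : [set A | G (@beta_basic X A)] (~` A).
    by have [x []] := @filter_ex _ H _ _ (filterI HA HnA).
  apply: filterS GnA => q nqA.
  by have [] := in_ultra_setVsetC A (ultrasetP q).
exists (Beta pU); split=> // V /beta_nbhsP[A GA AV].
exact: filterS AV GA.
Qed.

Lemma beta_ultra_not {X : Type} (p : beta X) (A : set X) : p (~` A) <-> ~ p A.
Proof.
split=> [pnA pA|npA]; last by have [] := in_ultra_setVsetC A (ultrasetP p).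
by have [x []] := @filter_ex _ p _ _ (@filterI _ p _ _ _ pA pnA).
Qed.

Lemma beta_basic_closed (X : Type) (A : set X) : closed (@beta_basic X A).
Proof.
rewrite -openC; suff -> : ~` beta_basic A = beta_basic (~` A).
  exact: beta_basic_open.
by rewrite eqEsubset; split=> p /beta_ultra_not.
Qed.

Lemma beta_hausdorff (X : Type) : hausdorff_space (beta X).
Proof.
move=> p q pq; apply: beta_eq.
suff sub A : p A -> q A.
  move=> A; split; first exact: sub.
  by move=> qA; apply: contrapT => /beta_ultra_not /sub /beta_ultra_not.
move=> pA; apply: contrapT => /beta_ultra_not qnA.
have [||r [rA /beta_ultra_not]] := pq (beta_basic A) (beta_basic (~` A)).
- by apply/beta_nbhsP; exists A.
- by apply/beta_nbhsP; exists (~` A).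
- by [].
Qed.

(** * Extension of maps to ultrafilters *)

Section BetaMap.
Context {X Y : Type}.
Variable f : X -> Y.

Lemma beta_map_ultra (p : beta X) : UltraFilter [set A | p (f @^-1` A)].
Proof.
have pF : ProperFilter [set A | p (f @^-1` A)].
  apply: Build_ProperFilter_ex.
    by move=> A pA; have [x] := @filter_ex _ p _ _ pA; exists (f x).
split=> // G GF sub; rewrite eqEsubset; split=> // A GA.
apply: contrapT => /beta_ultra_not pnA; have GnA := sub (~` A) pnA.
by have [x []] := @filter_ex _ G _ _ (filterI GA GnA).
Qed.

(** The pushforward of ultrafilters, which is the continuous extension of [f]. *)
Definition beta_map (p : beta X) : beta Y := Beta (beta_map_ultra p).

End BetaMap.

Lemma beta_mapM {X Y : semigroupType} (f : {multiplicative X -> Y}) :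
  {morph beta_map f : p q / p * q}.
Proof.
move=> p q; apply: beta_eq => A; rewrite beta_mulE /=.
rewrite /beta_mul_system /=.
suff -> : (fun x => q [set y | A (f (x * y))]) =
          (fun x => q [set y | A (f x * f y)]) by [].
by apply/funext => x; congr (ultraset q _); apply/funext => y; rewrite /= gmulfM.
Qed.

(** * Ultrafilters on [M] lying over [p] *)

Section LimitPoints.
Context {M : semigroupType} {PT : pred M} {T : subSemigroupType PT}.
Context {C : rightTopologicalSemigroupType} (phi : {multiplicative T -> C}).
Variable p : C.

(* The image in [beta M] of the fiber over [p] of the continuous extension of
   [phi] to [beta T]. *)
Definition limit_points : set (beta M) :=
  [set z | forall V, nbhs p V -> z [set val t | t in phi @^-1` V]].

Lemma limit_points_closed : closed limit_points.
Proof.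
have -> : limit_points =
    \bigcap_(V in nbhs p) beta_basic [set val t | t in phi @^-1` V] by [].
by apply: closed_bigI => V _; exact: beta_basic_closed.
Qed.

(** A point of the fiber of [phib] over [p] is pushed forward along [val]. *)
Lemma limit_points_nonempty (phib : beta T -> C) :
  continuous phib -> (forall t, phib (principal t) = phi t) ->
  range phib p -> limit_points !=set0.
Proof.
move=> phib_cont phib_ext [v _ vp]; exists (beta_map val v) => V pV /=.
have /beta_nbhsP[A vA AV] : nbhs v (phib @^-1` V).
  by apply: phib_cont; rewrite vp.
apply: (@filterS _ v _ _ _ _ vA) => t At; exists t => //=.
by rewrite -phib_ext; apply: AV; exact/principal_filterP.
Qed.

Lemma limit_points_mul (z1 z2 : beta M) :
  range phi `<=` topological_center C -> p * p = p ->
  limit_points z1 -> limit_points z2 -> limit_points (z1 * z2).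
Proof.
move=> phi_center pp z1p z2p V; rewrite nbhsE => -[W [Wo Wp] WV].
(* Continuity of right multiplication by [p], together with [p * p = p], controls the left
   factor. *)
have Wpp : nbhs p ((fun x => x * p) @^-1` W).
  by apply: mulgr_continuous; rewrite pp; apply: open_nbhs_nbhs.
rewrite beta_mulE; apply: (@filterS _ z1 _ _ _ _ (z1p _ Wpp)) => _ [t1 /= Wt1 <-].
(* The left factor is now fixed in the topological center, so the right factor may vary near [p]. *)
have Wt1' : nbhs p ((fun x => phi t1 * x) @^-1` W).
  have : topological_center C (phi t1) by apply: phi_center; exists t1.
  by apply; apply: open_nbhs_nbhs.
apply: (@filterS _ z2 _ _ _ _ (z2p _ Wt1')) => _ [t2 /= Wt2 <-].
by exists (t1 * t2); rewrite /= ?gmulfM //; apply: WV.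
Qed.

Section Absorption.
Context {PS : pred M} {S : subSemigroupType PS}.
Hypotheses (Tideal : two_sided_ideal [set x : M | PT x]).
Hypothesis (phi_indep : independent S phi).

(** The ideal property keeps [s * t] in [T] and independence gives it the same value as [t], so
    every [s] qualifies, whatever [x] is. *)
Lemma limit_points_mull (x : beta S) (z : beta M) :
  limit_points z -> limit_points (beta_map val x * z).
Proof.
move=> zp V pV; rewrite beta_mulE /=; apply: (@filterE _ x) => s.
apply: (@filterS _ z _ _ _ _ (zp V pV)) => _ [t /= Vt <-].
have [/= Tst _] := Tideal.2 (val s) (val t) (valP t).
exists (Sub (val s * val t) Tst); rewrite /= ?SubK //.
by rewrite (phi_indep s t _).1 ?SubK.
Qed.

Lemma limit_points_mulr (x : beta S) (z : beta M) :
  limit_points z -> limit_points (z * beta_map val x).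
Proof.
move=> zp V pV; rewrite beta_mulE /=.
apply: (@filterS _ z _ _ _ _ (zp V pV)) => _ [t /= Vt <-].
apply: (@filterE _ x) => s /=.
have [/= _ Tts] := Tideal.2 (val s) (val t) (valP t).
exists (Sub (val t * val s) Tts); rewrite /= ?SubK //.
by rewrite (phi_indep s t _).2 ?SubK.
Qed.

End Absorption.
End LimitPoints.

Theorem theorem2p4 (M : semigroupType) (PS PT : pred M)
    (S : subSemigroupType PS) (T : subSemigroupType PT)
    (hST : forall x : M, PS x \/ PT x)
    (hT : two_sided_ideal [set x : M | PT x])
    (C : rightTopologicalSemigroupType)
    (hCcompact : compact [set: C])
    (hChausdorff : hausdorff_space C)
    (phi : {multiplicative T -> C})
    (hphi_indep : independent S phi)
    (hphi_center : range phi `<=` topological_center C)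
    (phib : beta T -> C)
    (hphib_cont : continuous phib)
    (hphib_ext : forall t : T, phib (principal t) = phi t)
    (F : set {multiplicative M -> S})
    (hFfin : finite_set F)
    (hFne : F !=set0)
    (hFid : forall nu : {multiplicative M -> S}, F nu ->
              forall s : S, nu (val s) = s)
    (D : set S)
    (hD : piecewise_syndetic D)
    (p : C)
    (hp_idem : p * p = p)
    (hp_range : range phib p)
    (U : set C)
    (hU : nbhs p U) :
  exists w : T, U (phi w) /\
    forall nu : {multiplicative M -> S}, F nu -> D (nu (val w)).
Proof.
pose Z := limit_points phi p.
pose inS : beta S -> beta M := beta_map val.
have inSM : {morph inS : x y / x * y} by exact: beta_mapM.
have [q Kq qD] := hD.
have [r [rr qr rmin]] :=
  smallest_ideal_idempotent (@beta_compact S) (@beta_hausdorff S) q Kq.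
have ZSl x z : Z z -> Z (inS x * z) by exact: limit_points_mull.
have ZSr x z : Z z -> Z (z * inS x) by exact: limit_points_mulr.
have ZM z1 z2 : Z z1 -> Z z2 -> Z (z1 * z2) by exact: limit_points_mul.
have [|||_ [v Zv <-] vrvr] := @idempotent_exists (beta M) (@beta_compact M)
    (@beta_hausdorff M) [set z * inS r | z in Z].
- apply: closed_mulr; [exact: beta_compact|exact: beta_hausdorff|].
  exact: limit_points_closed.
- have [z Zz] := limit_points_nonempty _ _ _ hphib_cont hphib_ext hp_range.
  by exists (z * inS r), z.
(* Absorption puts [x * inS r] back in [Z]. *)
- move=> _ _ [x Zx <-] [y Zy <-]; exists (x * inS r * y); last by rewrite !mulgA.
  by apply/ZM/Zy/ZSr.
have irr : inS r * inS r = inS r by rewrite -inSM rr.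
(* The extra left factor yields [inS r * w = w]; idempotency survives because [inS r] is already a
   right identity for [v * inS r]. *)
pose w := inS r * (v * inS r).
have Zqw : Z (inS q * w) by apply/ZSl/ZSl/ZSr.
have wr : w * inS r = w by rewrite /w -!mulgA irr.
have rw : inS r * w = w by rewrite /w mulgA irr.
have ww : w * w = w by rewrite {2}/w mulgA wr /w -mulgA vrvr.
have nuw nu : F nu -> beta_map nu (inS q * w) = q.
  (* Since [nu] is the identity on [S], its extension is a left inverse of [inS]. *)
  move=> Fnu; have nuS x : beta_map nu (inS x) = x.
    apply: beta_eq => A /=; suff -> : val @^-1` (nu @^-1` A) = A by [].
    by apply/funext => s; rewrite /preimage /= hFid.
  rewrite beta_mapM nuS -[RHS]qr; congr (q * _); apply: rmin.
  - by rewrite -beta_mapM ww.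
  - by rewrite -[in LHS](nuS r) -beta_mapM wr.
  - by rewrite -[in LHS](nuS r) -beta_mapM rw.
(* Finiteness of [F] makes this intersection a member of the ultrafilter [inS q * w], whose image
   [q] under each [nu] contains [D]. *)
have [|m [[w' Uw' <-] Dw']] := @filter_ex _ (inS q * w) _
    ([set val t | t in phi @^-1` U] `&` \bigcap_(nu in F) nu @^-1` D).
  apply: filterI; first exact: Zqw.
  apply: filter_finite_bigcap => // nu Fnu.
  by have : beta_map nu (inS q * w) D by rewrite nuw.
by exists w'; split=> // nu Fnu; exact: Dw'.
Qed.
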